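(* Let $p\ge q\ge r\ge 0$ be integers with $p+q+r=n-3$. Then (i) if $q\ge 1$, $F(S_{p,q,r}) < F(S_{p+1,q-1,r})$; and (ii) if $r\ge 1$, $F(S_{p,q,r}) < F(S_{p,q+1,r-1})$.
   Context: All graphs are finite and simple. The F-index of a graph $G$ is $F(G)=\sum_{v\in V(G)} d_G(v)^3$. For integers $p,q,r\ge 0$, $S_{p,q,r}$ is the graph obtained from a triangle $xyz$ by attaching $p$ new leaves (vertices adjacent only to $x$) to $x$, $q$ new leaves to $y$ and $r$ new leaves to $z$; it has $p+q+r+3$ vertices. *)

(* Defs.v *)
From mathcomp Require Import all_boot.

Set Implicit Arguments.
Unset Strict Implicit.
Unset Printing Implicit Defensive.

Record sgraph := SGraph {
  vertex :> finType;
  adj : rel vertex;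
  adj_sym : symmetric adj;
  adj_irrefl : irreflexive adj
}.

Definition deg (G : sgraph) (v : G) : nat := #|[set w : G | adj v w]|.

Definition F_index (G : sgraph) : nat := \sum_(v : G) deg v ^ 3.

(** The three triangle vertices are the elements of ['I_3]. *)
Definition tx : 'I_3 := @Ordinal 3 0 isT.
Definition ty : 'I_3 := @Ordinal 3 1 isT.
Definition tz : 'I_3 := @Ordinal 3 2 isT.

Section TriangleWithLeaves.
Variables p q r : nat.

(** Vertices of S_{p,q,r}: the triangle, then the leaves attached to x, y, z,
    in this order. *)
Definition S_leaf : finType := ('I_p + 'I_q + 'I_r)%type.
Definition S_vertex : finType := ('I_3 + S_leaf)%type.

Definition S_hub (l : S_leaf) : 'I_3 :=
  match l with
  | inl (inl _) => tx
  | inl (inr _) => ty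
  | inr _ => tz
  end.

Definition S_adj (u v : S_vertex) : bool :=
  match u, v with
  | inl i, inl j => i != j
  | inl i, inr l => i == S_hub l
  | inr l, inl i => i == S_hub l
  | inr _, inr _ => false
  end.

Lemma S_adj_sym : symmetric S_adj.
Proof. by move=> [i|l] [j|m] //=; rewrite eq_sym. Qed.

Lemma S_adj_irrefl : irreflexive S_adj.
Proof. by move=> [i|l] //=; rewrite eqxx. Qed.

Definition S_graph : sgraph := SGraph S_adj_sym S_adj_irrefl.

End TriangleWithLeaves.

(* Main.v *)
Require Import Defs.
From mathcomp Require Import all_boot.
From mathcomp Require Import zify.

(** Hubs have degree 2 plus their number of leaves, and leaves have degree 1, so the F-index has a
    closed form ([F_index_S_graph]): three cubes plus the leaf count. Moving a leaf preserves that
    count and changes two cubes; by strict convexity of the cube ([cube_spread]), moving it to a hub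
    with at least as many leaves increases their sum. *)

Lemma deg_sum (G : sgraph) (v : G) : deg v = \sum_(w : G) adj v w.
Proof. by rewrite /deg cardsE -sum1_card big_mkcond. Qed.

Lemma deg_hub (p q r : nat) (i : 'I_3) :
  @deg (S_graph p q r) (inl i) =
    2 + p * (i == tx) + q * (i == ty) + r * (i == tz).
Proof.
rewrite deg_sum !big_sumType /= !sum_nat_const !card_ord.
have -> : \sum_(j < 3) (i != j) = 2.
  by case: i => [[|[|[|//]]] hi]; rewrite !big_ord_recl big_ord0.
by rewrite !addnA.
Qed.

Lemma deg_leaf (p q r : nat) (l : S_leaf p q r) :
  @deg (S_graph p q r) (inr l) = 1.
Proof.
rewrite deg_sum big_sumType /= [X in _ + X]big1 // addn0.
by rewrite (bigD1 (S_hub l)) //= eqxx big1 // => j /negbTE ->.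
Qed.

Lemma F_index_S_graph (p q r : nat) :
  F_index (S_graph p q r) =
    (p + 2) ^ 3 + (q + 2) ^ 3 + (r + 2) ^ 3 + (p + q + r).
Proof.
rewrite /F_index big_sumType /=.
under [X in _ + X]eq_bigr do rewrite deg_leaf.
under eq_bigr do rewrite deg_hub.
rewrite sum_nat_const !card_sum !card_ord !big_ord_recl big_ord0 /=.
by rewrite exp1n !(muln0, muln1, addn0) !addnA !(addnC 2).
Qed.

(** The increment from [x ^ 3] to [x.+1 ^ 3] is [3 * x ^ 2 + 3 * x + 1], strictly increasing in [x];
    compare it at [b] and [a]. *)
Lemma cube_spread (a b : nat) :
  b < a -> a ^ 3 + b.+1 ^ 3 < a.+1 ^ 3 + b ^ 3.
Proof. by move=> lt_ba; rewrite !expnS !expn0; nia. Qed.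

Theorem theorem3 (n p q r : nat) (hpq : q <= p) (hqr : r <= q)
  (hn : 3 <= n) (hsum : p + q + r = n - 3) :
  (1 <= q -> F_index (S_graph p q r) < F_index (S_graph p.+1 q.-1 r)) /\
  (1 <= r -> F_index (S_graph p q r) < F_index (S_graph p q.+1 r.-1)).
Proof.
rewrite !F_index_S_graph; split.
  case: q hpq {hqr hsum} => // q lt_qp _.
  (* Here [q] is already one less than the original count, so the weak ordering of the counts gives
     the strict inequality, even when they tie. *)
  have /cube_spread: q + 2 < p + 2 by rewrite ltn_add2r.
  by rewrite succnK (addSn p 2) (addSn q 2); lia.
case: r hqr {hsum} => // r lt_rq _.
have /cube_spread: r + 2 < q + 2 by rewrite ltn_add2r.
(* Pulling the successors outward gives the goal the same cubes as [cube_spread]; what remains is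
   linear in them. *)
by rewrite succnK (addSn q 2) (addSn r 2); lia.
Qed.
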